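(* Let $\Gamma:\mathfrak g=\bigoplus_{j\in\mathbb Z}\mathfrak g_j$ be a $\mathbb Z$-grading of the Lie algebra $\mathfrak g$ and let $a>1$ be an integer such that $e\in\mathfrak g_a$. Then $\Gamma$ is admissible for $e$ (with this integer $a$) if and only if $\mathfrak g_{\le -a}\cap\mathfrak g^e=\{0\}$.
   Context: $\mathfrak g$ is a finite-dimensional simple Lie algebra over $\mathbb C$ with Killing form $\langle\cdot,\cdot\rangle$; $e\in\mathfrak g$ is a nilpotent element; $\mathfrak g^e$ is the centralizer of $e$ in $\mathfrak g$; $U^\perp$ is the orthogonal of a subspace $U\subseteq\mathfrak g$ for the Killing form. For a grading $\mathfrak g=\bigoplus_j\mathfrak g_j$ (so $[\mathfrak g_i,\mathfrak g_j]\subseteq\mathfrak g_{i+j}$), write $\mathfrak g_{\le k}=\bigoplus_{j\le k}\mathfrak g_j$, $\mathfrak g_{<k}=\bigoplus_{j<k}\mathfrak g_j$; a subspace $V$ is graded if $V=\bigoplus_j(V\cap\mathfrak g_j)$. A pair $(\mathfrak m,\mathfrak n)$ of subalgebras of $\mathfrak g$ is admissible for $e$ relative to a $\mathbb Z$-grading $\Gamma:\mathfrak g=\bigoplus_{j\in\mathbb Z}\mathfrak g_j$ and an integer $a>1$ if: (A1) $e\in\mathfrak g_a$; (A2) $\mathfrak m,\mathfrak n$ are graded and $\mathfrak g_{\le -a}\subseteq\mathfrak m\subseteq\mathfrak n\subseteq\mathfrak g_{<0}$; (A3) $\mathfrak m^\perp\cap[\mathfrak g,e]=[\mathfrak n,e]$;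 (A4) $\mathfrak n\cap\mathfrak g^e=\{0\}$; (A5) $[\mathfrak n,\mathfrak m]\subseteq\mathfrak m$; (A6) $\dim\mathfrak m+\dim\mathfrak n=\dim\mathfrak g-\dim\mathfrak g^e$. The grading $\Gamma$ is admissible for $e$ (with $e\in\mathfrak g_a$, $a>1$) if there exists a pair admissible for $e$ relative to $\Gamma$ and $a$. *)

(* Defs.v *)
From HB Require Import structures.
From mathcomp Require Import all_boot all_order all_algebra sesquilinear.
From mathcomp Require Import complex reals.

Set Implicit Arguments.
Unset Strict Implicit.
Unset Printing Implicit Defensive.

Import Order.TTheory GRing.Theory Num.Theory passmx.
Local Open Scope ring_scope.

HB.mixin Record Vector_isLie (F : fieldType) L of Vector F L := {
  lie : L -> L -> L;
  lie_bilinear : bilinear_for *:%R *:%R lie;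
  lie_alt : forall x, lie x x = 0;
  lie_jacobi : forall x y z,
    lie x (lie y z) + lie y (lie z x) + lie z (lie x y) = 0
}.

#[short(type="lieAlgType")]
HB.structure Definition LieAlgebra (F : fieldType) :=
  {L of Vector_isLie F L & Vector F L}.

HB.instance Definition _ (F : fieldType) (L : lieAlgType F) :=
  bilinear_isBilinear.Build F L L L *:%R *:%R (@lie F L) lie_bilinear.

HB.instance Definition _ (F : fieldType) (L : lieAlgType F) (x : L) :=
  GRing.isLinear.Build F L L *:%R (@lie F L x) (lie_bilinear.2 x).

Section LieAlgebraTheory.
Variables (F : fieldType) (L : lieAlgType F).
Implicit Types (x y e : L) (U V I : {vspace L}).

Definition lie_ad x : 'End(L) := linfun (lie x).

Definition lie_adr y : 'End(L) := linfun (applyr (@lie F L) y).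

Lemma lie_adE x y : lie_ad x y = lie x y.
Proof. by rewrite lfunE. Qed.

Lemma lie_adrE x y : lie_adr y x = lie x y.
Proof. by rewrite lfunE. Qed.

Lemma lie_ad_is_linear : linear lie_ad.
Proof.
move=> c x y; apply/lfunP => z.
by rewrite add_lfunE scale_lfunE !lie_adE (lie_bilinear.1 z).
Qed.

Definition lie_subalgebra U := forall x y, x \in U -> y \in U -> lie x y \in U.

Definition lie_ideal I := forall x y, y \in I -> lie x y \in I.

Definition lie_simple :=
  (exists x y, lie x y != 0) /\
  (forall I, lie_ideal I -> I = 0%VS \/ I = fullv).

(* In a semisimple Lie algebra, "x is nilpotent" means that ad x is. *)
Definition lie_nilpotent x := exists k, forall y, iter k (lie x) y = 0.

Definition centralizer e : {vspace L} := lker (lie_adr e).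

Lemma mem_centralizer e x : (x \in centralizer e) = (lie x e == 0).
Proof. by rewrite memv_ker lie_adrE. Qed.

(* The subspace [U, e]. *)
Definition lie_img U e : {vspace L} := (lie_adr e @: U)%VS.

Definition lfun_trace (f : 'End(L)) : F :=
  \tr (mxof (vbasis fullv) (vbasis fullv) f).

Definition killing x y : F := lfun_trace (lie_ad x \o lie_ad y)%VF.

Lemma killingC x y : killing x y = killing y x.
Proof.
rewrite /killing /lfun_trace !(mxof_comp _ _ (vbasisP _)).
exact: mxtrace_mulC.
Qed.

Lemma killing_linearl y : linear_for *%R (killing^~ y).
Proof.
move=> c x1 x2; rewrite /killing lie_ad_is_linear comp_lfunDl -comp_lfunZl.
by rewrite /lfun_trace !linearP.
Qed.

Lemma killing_bilinear : bilinear_for *%R *%R killing.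
Proof.
split=> [|x c y1 y2]; first exact: killing_linearl.
by rewrite killingC killing_linearl !(killingC x).
Qed.

HB.instance Definition _ :=
  bilinear_isBilinear.Build F L L F *%R (idfun \; *%R) killing killing_bilinear.

HB.instance Definition _ := isHermitianSesquilinear.Build F L false idfun
  killing (fun x y => etrans (killingC x y) (esym (mul1r (killing y x)))).

Definition killing_orth U : {vspace L} := orthov killing U.

Lemma mem_killing_orth U x :
  reflect (forall u, u \in U -> killing x u = 0) (x \in killing_orth U).
Proof. exact: mem_orthovP. Qed.

(* Since L is finite-dimensional, only finitely many pieces of a Z-grading
   are nonzero; recording their indices in grade_supp makes every sum of
   pieces a sum over the finite type seq_sub grade_supp. *)
Record zgrading := ZGrading {
  piece :> int -> {vspace L};
  grade_supp : seq int;
  grade_suppP : forall j, (j \in grade_supp) = (piece j != 0%VS);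
  grade_direct : directv (\sum_(j : seq_sub grade_supp) piece (val j));
  grade_full : (\sum_(j : seq_sub grade_supp) piece (val j))%VS = fullv;
  grade_lie : forall i j x y,
    x \in piece i -> y \in piece j -> lie x y \in piece (i + j)
}.

Section Admissible.
Variable G : zgrading.

Definition grade_le (k : int) : {vspace L} :=
  (\sum_(j : seq_sub (grade_supp G) | (val j <= k)%R) G (val j))%VS.

Definition grade_lt (k : int) : {vspace L} :=
  (\sum_(j : seq_sub (grade_supp G) | (val j < k)%R) G (val j))%VS.

(* The sum of the V :&: G j is automatically direct. *)
Definition graded_subspace V :=
  V = (\sum_(j : seq_sub (grade_supp G)) (V :&: G (val j)))%VS.

Record admissible_pair (a : int) e (m n : {vspace L}) : Prop := AdmissiblePair {
  adm_subalg_m : lie_subalgebra m;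
  adm_subalg_n : lie_subalgebra n;
  adm_e : e \in G a;
  adm_graded_m : graded_subspace m;
  adm_graded_n : graded_subspace n;
  adm_le_m : (grade_le (- a) <= m)%VS;
  adm_m_n : (m <= n)%VS;
  adm_n_lt : (n <= grade_lt 0)%VS;
  adm_orth : (killing_orth m :&: lie_img fullv e)%VS = lie_img n e;
  adm_cap : (n :&: centralizer e)%VS = 0%VS;
  adm_norm : forall x y, x \in n -> y \in m -> lie x y \in m;
  (* The truncated subtraction is harmless: centralizer e is a subspace. *)
  adm_dim : (\dim m + \dim n = \dim {:L} - \dim (centralizer e))%N
}.

Definition admissible_grading (a : int) e :=
  exists m n : {vspace L}, admissible_pair a e m n.

End Admissible.

End LieAlgebraTheory.

Arguments lie_simple {F} L.
Arguments zgrading {F} L.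

(* Main.v *)
(** Put V_j for a complement of the degree-j part of the centralizer of e in
    the degree-j piece.  The pair m = sum of the V_j with 2j < -a and
    n = sum of the V_j with 2j <= -a is admissible as soon as the centralizer
    meets no degree <= -a: brackets of elements of n land in degrees <= -a,
    where V_j is the whole piece, and [(x, y) |-> <[x, e], y>] puts V_i and V_j
    in duality when i + j = -a and makes them orthogonal otherwise, which
    gives (A3) and (A6).

    This needs the Killing form to be nondegenerate; otherwise simplicity makes
    it identically 0.  In that case fix x and let D act on the generalized
    eigenspace of ad x for the eigenvalue l as the conjugate of l.  Conjugation
    being additive, D is a derivation, so tr (D o ad [y, z]) = <D y, z> = 0;
    since brackets span the algebra, 0 = tr (D o ad x), which is the sum of the
    |l|^2.  Hence every ad x is nilpotent, and Engel's theorem contradicts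
    simplicity. *)

Require Import Defs.
From HB Require Import structures.
From mathcomp Require Import all_boot all_order all_algebra sesquilinear.
From mathcomp Require Import complex reals zify.
Import Order.TTheory GRing.Theory Num.Theory passmx.
Local Open Scope ring_scope.

Set Implicit Arguments.
Unset Strict Implicit.
Unset Printing Implicit Defensive.

(** * Generalized eigenspaces and traces *)

Section GeneralizedEigenspaces.
Variables (F : fieldType) (V : vectType F).
Implicit Types (f : 'End(V)) (a : F) (v : V).

(** Builds two maps that are scalar on each summand: the conjugate-eigenvalue map of
    [killing0_nilpotent] and the degree map of a grading. *)
Lemma diagonal_lfun (I : finType) (U : I -> {vspace V}) (c : I -> F) :
    directv (\sum_i U i)%VS -> (\sum_i U i)%VS = fullv ->
  exists D : 'End(V), forall i v, v \in U i -> D v = c i *: v.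
Proof.
move=> dU fU.
exists (\sum_i c i *: sumv_pi (\sum_i U i)%VS i) => i v Ui.
have Ef j : (sumv_pi (\sum_i U i)%VS j) v = if j == i then v else 0.
  have /forall_inP/(_ j isT)/eqP // :
    [forall (j | true), sumv_pi (\sum_i U i)%VS j v == if j == i then v else 0].
  rewrite -(directv_sum_unique dU) => [|k _|k _].
  - by rewrite sumv_pi_sum ?fU ?memvf // -big_mkcond big_pred1_eq.
  - exact: memv_sum_pi.
  - by case: eqP => [->|_]; rewrite ?mem0v.
rewrite sum_lfunE (bigD1 i) //= scale_lfunE Ef eqxx big1 ?addr0 // => j /negPf ji.
by rewrite scale_lfunE Ef ji scaler0.
Qed.

(* Locked: unification otherwise unfolds the iterate and diverges. *)
Fact geigen_key : unit. Proof. by []. Qed.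
Definition geigen_def f k a : {vspace V} :=
  lker (iter k (comp_lfun (f - a *: \1%VF)) \1%VF).
Definition geigen := locked_with geigen_key geigen_def.

Lemma mem_geigen f k a v :
  (v \in geigen f k a) = (iter k (fun w => f w - a *: w) v == 0).
Proof.
rewrite [geigen]unlock memv_ker; congr (_ == 0); elim: k v => [|k IHk] v /=.
  by rewrite id_lfunE.
by rewrite comp_lfunE IHk add_lfunE opp_lfunE scale_lfunE id_lfunE.
Qed.

Lemma mem_geigen0 f a v : (v \in geigen f 0 a) = (v == 0).
Proof. by rewrite mem_geigen. Qed.

Lemma mem_geigenS f k a v :
  (v \in geigen f k.+1 a) = (f v - a *: v \in geigen f k a).
Proof. by rewrite !mem_geigen iterSr. Qed.

Lemma geigen_stable f k a v : v \in geigen f k a -> f v \in geigen f k a.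
Proof.
elim: k v => [|k IHk] v; first by rewrite !mem_geigen0 => /eqP->; rewrite linear0.
by rewrite 2!mem_geigenS => /IHk; rewrite (linearB f) (linearZ_LR f).
Qed.

Lemma geigenS f k a : (geigen f k a <= geigen f k.+1 a)%VS.
Proof.
by apply/subvP => v va; rewrite mem_geigenS memvB ?memvZ ?geigen_stable.
Qed.

Lemma geigen_addn f k m a : (geigen f k a <= geigen f (m + k) a)%VS.
Proof.
by elim: m => [|m IHm]; rewrite ?subvv // (subv_trans IHm) ?addSn ?geigenS.
Qed.

Lemma geigen_eigenvector f k a b v :
  v \in geigen f k a -> f v = b *: v -> v != 0 -> b = a.
Proof.
move=> vk fv v0; apply/eqP; apply: contraNT v0; rewrite -subr_eq0 => ba.
elim: k vk => [|k IHk]; first by rewrite mem_geigen0.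
rewrite mem_geigenS fv -scalerBl => vk; apply: IHk.
by have := memvZ (b - a)^-1 vk; rewrite scalerA mulVf ?scale1r.
Qed.

Lemma sub_kermxpoly_XsubC n (A : 'M[F]_n) k a (u : 'rV_n) :
  (u <= kermxpoly A (('X - a%:P) ^+ k))%MS =
    (iter k (fun w => w *m A - a *: w) u == 0).
Proof.
case: n => [|n] in A u *; first by rewrite !thinmx0 sub0mx eqxx.
rewrite (sameP sub_kermxP eqP) rmorphXn rmorphB /= horner_mx_X horner_mx_C.
congr (_ == 0); elim: k => [|k IHk]; first by rewrite mulmx1.
by rewrite exprSr mulmxA IHk mulmxBr mul_mx_scalar.
Qed.

Local Notation b := (vbasis (@fullv F V)).
Let bP : basis_of fullv b := vbasisP fullv.
Local Notation rV := (rVof b).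
Local Notation mx := (mxof b b).

(** Passes to matrices, where kernels of pairwise coprime polynomials are known to be
    independent. *)
Lemma mem_geigen_mx f k a v :
  (v \in geigen f k a) = (rV v <= kermxpoly (mx f) (('X - a%:P) ^+ k))%MS.
Proof.
rewrite mem_geigen sub_kermxpoly_XsubC -(rVof_eq0 bP); congr (_ == 0).
elim: k => //= k <-.
rewrite -(rVof_app b bP); by rewrite !linearB linearZ.
Qed.

Lemma coprimep_XsubC_exp (x y : F) k :
  x != y -> coprimep (('X - x%:P) ^+ k) (('X - y%:P) ^+ k).
Proof.
move=> xy; rewrite coprimep_expl ?coprimep_expr ?coprimep_XsubC2 //.
by rewrite subr_eq0 eq_sym.
Qed.

Lemma geigen_direct f k (s : seq F) :
  directv (\sum_(a : seq_sub s) geigen f k (val a))%VS.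
Proof.
apply/directv_sum_independent => us Us us0 i _.
pose p (a : seq_sub s) := ('X - (val a)%:P) ^+ k.
have dp : {in predT &, forall i j, j != i -> coprimep (p i) (p j)}.
  by move=> x y _ _ yx; apply: coprimep_XsubC_exp; rewrite eq_sym.
have /mxdirect_sumsP/(_ i isT) d0 := mxdirect_sum_kermx (mx f) dp.
apply/eqP; rewrite -(rVof_eq0 bP) -submx0 -d0 sub_capmx.
rewrite -mem_geigen_mx Us //=.
have -> : us i = - \sum_(j | j != i) us j.
  by apply/eqP; rewrite -addr_eq0; move: us0; rewrite (bigD1 i) //= => ->.
rewrite linearN eqmx_opp linear_sum summx_sub_sums // => j _.
by rewrite -mem_geigen_mx Us.
Qed.

(** By Cayley-Hamilton it is enough that the characteristic polynomial divides the product of the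
    [('X - a%:P) ^+ k]. Both [s] and [k] may be larger than the roots require, which
    [killing0_nilpotent] exploits. *)
Lemma geigen_full (r s : seq F) f k :
    (\dim {:V} <= k)%N -> {subset r <= s} ->
    char_poly (mx f) = \prod_(z <- r) ('X - z%:P) ->
  (\sum_(a : seq_sub s) geigen f k (val a))%VS = fullv.
Proof.
move=> lek rs fr; apply/eqP; rewrite eqEsubv subvf /=; apply/subvP => v _.
pose p (a : seq_sub s) := ('X - (val a)%:P) ^+ k.
have cp : {in predT &, forall i j, j != i -> coprimep (p i) (p j)}.
  by move=> x y _ _ yx; apply: coprimep_XsubC_exp; rewrite eq_sym.
have dvd : char_poly (mx f) %| \prod_a p a.
  rewrite prodrXl fr.
  have rk : (size r <= k)%N.
    apply: leq_trans lek; rewrite -ltnS -(size_char_poly (mx f)) fr.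
    by rewrite size_prod_XsubC.
  (* Every root in [r] divides the squarefree product over [s] once, so the exponent [size r]
     absorbs all multiplicities. *)
  apply: (@dvdp_trans _ ((\prod_(a : seq_sub s) ('X - (val a)%:P)) ^+ size r));
    last exact: dvdp_exp2l.
  elim: r rs {fr rk} => [|z r IHr] rs; first by rewrite big_nil dvd1p.
  rewrite big_cons exprS; apply: dvdp_mul; last first.
    by apply: IHr => x xr; rewrite rs // inE xr orbT.
  have zs : z \in s by rewrite rs // inE eqxx.
  by rewrite (bigD1 (SeqSub zs)) //= dvdp_mulIl.
have : (rV v <= \sum_a kermxpoly (mx f) (p a))%MS.
  rewrite -(kermxpoly_prod _ cp).
  case: (\dim _) (mx f) (rV v) dvd => [|n] A u dvd; rewrite ?thinmx0 ?sub0mx //.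
  rewrite (submx_trans (submx1 _)) // (kermxpoly_min _) //.
  exact: dvdp_trans (mxminpoly_dvd_char _) dvd.
case/sub_sumsmxP => u /(congr1 (vecof b)); rewrite (rVofK bP) => ->.
rewrite linear_sum memv_sumr //= => a _.
by rewrite mem_geigen_mx (vecofK bP) submxMl.
Qed.

Lemma leigenvalueP f a :
  reflect (exists2 v, v != 0 & f v = a *: v) (eigenvalue (mx f) a).
Proof.
apply: (iffP (@eigenvalueP _ _ _ _)) => [[u uA u0]|[v v0 fv]].
  exists (vecof b u); first by rewrite (vecof_eq0 bP).
  by rewrite (hom_vecof _ bP) uA linearZ.
exists (rV v); last by rewrite (rVof_eq0 bP).
by rewrite -(rVof_app b bP) fv linearZ.
Qed.

End GeneralizedEigenspaces.

(** The trace is the sum of the roots of the characteristic polynomial, and nonnegative terms with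
    zero sum all vanish. *)
Lemma ge0_eigenvalue_mxtrace0 (C : numClosedFieldType) n (A : 'M[C]_n) :
    (forall a, eigenvalue A a -> 0 <= a) -> \tr A = 0 ->
  forall a, eigenvalue A a -> a = 0.
Proof.
move=> Age0 trA a Aa; have [r] := closed_field_poly_normal (char_poly A).
rewrite (monicP (char_poly_monic A)) scale1r => defA.
have rootE z : eigenvalue A z = (z \in r).
  by rewrite eigenvalue_root_char defA root_prod_XsubC.
have sz : size r = n.
  by apply/succn_inj; rewrite -(size_char_poly A) defA size_prod_XsubC.
have r0 : size r != 0 by case: (r) Aa rootE => [|//] Aa /(_ a); rewrite Aa.
have := coefPn_prod_XsubC r0; rewrite -defA sz char_poly_trace; last first.
  by rewrite lt0n -sz.
rewrite trA => /eqP; rewrite eqr_opp eq_sym big_seq psumr_eq0; last first.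
  by move=> z; rewrite -rootE => /Age0.
by move/allP => /(_ a); rewrite -rootE Aa => /(_ isT)/eqP.
Qed.

(** * Derivations and the Killing form *)

Section LieAlgebra.
Variables (F : fieldType) (L : lieAlgType F).
Implicit Types (x y z : L) (U W k : {vspace L}) (D : 'End(L)).

Lemma lieDl y : {morph (@lie F L)^~ y : x z / x + z}.
Proof. by move=> x z; rewrite -!lie_adrE linearD. Qed.

Lemma lieDr x : {morph @lie F L x : y z / y + z}.
Proof. by move=> y z; rewrite -!lie_adE linearD. Qed.

Lemma lieNl y : {morph (@lie F L)^~ y : x / - x}.
Proof. by move=> x; rewrite -!lie_adrE linearN. Qed.

Lemma lieNr x : {morph @lie F L x : y / - y}.
Proof. by move=> y; rewrite -!lie_adE linearN. Qed.

Lemma lieZl y c : {morph (@lie F L)^~ y : x / c *: x}.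
Proof. by move=> x; rewrite -!lie_adrE linearZ. Qed.

Lemma lieZr x c : {morph @lie F L x : y / c *: y}.
Proof. by move=> y; rewrite -!lie_adE linearZ. Qed.

Lemma lie0l y : lie 0 y = 0.
Proof. by rewrite -lie_adrE linear0. Qed.

Lemma lie0r x : lie x 0 = 0.
Proof. by rewrite -lie_adE linear0. Qed.

Lemma lie_suml (I : finType) (P : pred I) (xs : I -> L) y :
  lie (\sum_(i | P i) xs i) y = \sum_(i | P i) lie (xs i) y.
Proof.
by rewrite -lie_adrE linear_sum; apply: eq_bigr => i _; rewrite /= lie_adrE.
Qed.

Lemma lie_sumr (I : finType) (P : pred I) (xs : I -> L) y :
  lie y (\sum_(i | P i) xs i) = \sum_(i | P i) lie y (xs i).
Proof.
by rewrite -lie_adE linear_sum; apply: eq_bigr => i _; rewrite /= lie_adE.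
Qed.

Lemma lieC x y : lie x y = - lie y x.
Proof.
apply/eqP; rewrite -addr_eq0; apply/eqP.
by have := lie_alt (x + y); rewrite lieDl !lieDr !lie_alt add0r addr0.
Qed.

Lemma lie_leibniz x y z :
  lie x (lie y z) = lie (lie x y) z + lie y (lie x z).
Proof.
have /eqP := lie_jacobi x y z; rewrite -addrA addr_eq0 => /eqP->.
by rewrite opprD addrC (lieC z x) lieNr opprK (lieC z) opprK.
Qed.

Definition derivation D :=
  forall x y, D (lie x y) = lie (D x) y + lie x (D y).

Lemma lie_ad_derivation x : derivation (lie_ad x).
Proof. by move=> y z; rewrite !lie_adE lie_leibniz. Qed.

Lemma derivation_of_cover (I : finType) (U : I -> {vspace L}) D :
    (\sum_i U i)%VS = fullv ->
    (forall i j x y, x \in U i -> y \in U j ->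
      D (lie x y) = lie (D x) y + lie x (D y)) ->
  derivation D.
Proof.
move=> fU DU x y.
have /memv_sumP[xs Ux ->] : x \in (\sum_i U i)%VS by rewrite fU memvf.
have /memv_sumP[ys Uy ->] : y \in (\sum_i U i)%VS by rewrite fU memvf.
set s := \sum_i ys i; rewrite lie_suml !(linear_sum D) !lie_suml -big_split /=.
apply: eq_bigr => i _; rewrite /= /s !lie_sumr (linear_sum D) -big_split /=.
by apply: eq_bigr => j _; apply: DU (Ux i isT) (Uy j isT).
Qed.

Lemma lfun_traceC (f h : 'End(L)) :
  lfun_trace (f \o h)%VF = lfun_trace (h \o f)%VF.
Proof.
rewrite /lfun_trace !(mxof_comp _ _ (vbasisP _)); exact: mxtrace_mulC.
Qed.

Lemma lfun_traceB (f h : 'End(L)) :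
  lfun_trace (f - h) = lfun_trace f - lfun_trace h.
Proof. by rewrite /lfun_trace !linearB. Qed.

Lemma lie_ad_derivationE D x : derivation D ->
  lie_ad (D x) = (D \o lie_ad x)%VF - (lie_ad x \o D)%VF.
Proof.
move=> dD; apply/lfunP => y.
by rewrite add_lfunE opp_lfunE !comp_lfunE !lie_adE dD addrK.
Qed.

(** Both [lie_ad (lie x y)] and [lie_ad (D x)] are commutators; expanding them, the traces agree by
    cyclicity. *)
Lemma lfun_trace_derivation D x y : derivation D ->
  lfun_trace (D \o lie_ad (lie x y))%VF = killing (D x) y.
Proof.
move=> dD; rewrite /killing (lie_ad_derivationE x dD).
rewrite -[lie x y]lie_adE (lie_ad_derivationE y (lie_ad_derivation x)).
rewrite comp_lfunDr comp_lfunDl comp_lfunNl comp_lfunNr !lfun_traceB.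
by rewrite -!comp_lfunA (lfun_traceC (lie_ad x)) -!comp_lfunA.
Qed.

(** Cyclicity of the trace again. Inner derivations give invariance of the form, the degree
    derivation gives orthogonality of graded pieces. *)
Lemma killing_derivation D x y : derivation D ->
  killing (D x) y = - killing x (D y).
Proof.
move=> dD; apply/eqP; rewrite -addr_eq0 /killing !(lie_ad_derivationE _ dD).
rewrite comp_lfunDl comp_lfunDr comp_lfunNl comp_lfunNr !lfun_traceB.
by rewrite -!comp_lfunA addrA subrK subr_eq0 lfun_traceC -comp_lfunA.
Qed.

Lemma killing_lie x y z : killing (lie x y) z = killing x (lie y z).
Proof.
rewrite lieC -scaleN1r linearZl_LR /= -(lie_adE y x)
  (killing_derivation _ _ (lie_ad_derivation y)).
by rewrite mulN1r opprK lie_adE.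
Qed.

End LieAlgebra.

(** * Engel's theorem and nondegeneracy of the Killing form *)

Section Engel.
Variables (F : fieldType) (L : lieAlgType F).
Implicit Types (x y z : L) (U W K : {vspace L}) (D : 'End(L)).

Definition lie_stable K U := forall x u, x \in K -> u \in U -> lie x u \in U.

(* Pairs U <= W of stable subspaces stand for the quotient modules W / U of the
   usual induction. *)
Definition engel_property K := forall U W,
  lie_stable K U -> lie_stable K W -> (U <= W)%VS -> ~~ (W <= U)%VS ->
  exists w, [/\ w \in W, w \notin U & forall x, x \in K -> lie x w \in U].

Lemma engel_property_add_line K y :
    engel_property K -> (forall x, x \in K -> lie x y \in K) ->
    lie_nilpotent y ->
  engel_property (K + <[y]>)%VS.
Proof.
move=> EK Ky [k yk] U W sU sW UW WU.
have KS : {subset K <= (K + <[y]>)%VS} by apply/subvP/addvSl.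
have yS : y \in (K + <[y]>)%VS by apply: (subvP (addvSr K _)); rewrite memv_line.
have [||w [wW wU Kw]] := EK U W _ _ UW WU.
- by move=> x u /KS; apply: sU.
- by move=> x u /KS; apply: sW.
have iterP j : iter j (lie y) w \in W /\
    forall x, x \in K -> lie x (iter j (lie y) w) \in U.
  elim: j => [|j [jW jK]]; first by [].
  split=> [|x xK]; first exact: sW.
  rewrite iterS lie_leibniz memvD ?jK ?Ky //; first exact: sU (jK x xK).
have ex : exists j, iter j (lie y) w \in U by exists k; rewrite yk mem0v.
case: (ex_minnP ex) => -[|j] jU jmin; first by rewrite jU in wU.
exists (iter j (lie y) w); split; first exact: (iterP j).1.
  by apply/negP => /jmin; rewrite ltnn.
move=> _ /memv_addP[u uK [_ /vlineP[c ->] ->]].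
by rewrite lieDl lieZl memvD ?memvZ // (iterP j).2.
Qed.

(** The property of [K], applied to the pair of [K] inside the whole algebra, yields [y] outside [K]
    normalizing [K], so [K] grows by one dimension. *)
Lemma engel_chain d : (forall x : L, lie_nilpotent x) -> (d <= \dim {:L})%N ->
  exists K, [/\ lie_subalgebra K, \dim K = d & engel_property K].
Proof.
move=> nil; elim: d => [|d IHd] dL.
  exists 0%VS; split; rewrite ?dimv0 //.
    by move=> x y; rewrite !memv0 => /eqP-> _; rewrite lie0l.
  move=> U W _ _ _ /subvPn[w wW wU]; exists w; split=> // x.
  by rewrite memv0 => /eqP->; rewrite lie0l mem0v.
have [K [sK dK EK]] := IHd (ltnW dL).
have fK : ~~ (fullv <= K)%VS.
  by apply/negP => /dimvS; rewrite dK leqNgt dL.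
have [||y [_ yK Ky]] := EK K fullv _ _ (subvf K) fK.
- exact: sK.
- by move=> x u _ _; apply: memvf.
exists (K + <[y]>)%VS; split; last exact: engel_property_add_line.
  move=> x z /memv_addP[u uK [_ /vlineP[c ->] ->]].
  move=> /memv_addP[v vK [_ /vlineP[a ->] ->]].
  rewrite lieDl !lieDr !lieZl !lieZr lie_alt !scaler0 addr0.
  apply: (subvP (addvSl K _)).
  have yvK : lie y v \in K by rewrite lieC memvN Ky.
  by rewrite !memvD ?memvZ ?yvK ?Ky ?sK.
rewrite dimv_disjoint_sum; last first.
  apply/eqP; rewrite -subv0; apply/subvP => v /memv_capP[vK /vlineP[c vE]].
  rewrite memv0 vE scaler_eq0; apply: contraNT yK.
  rewrite negb_or => /andP[c0 _]; have := memvZ c^-1 vK.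
  by rewrite vE scalerA mulVf ?scale1r.
rewrite dim_vline dK; case: eqP yK => [->|_ _]; first by rewrite mem0v.
by rewrite addn1.
Qed.

(** Engel's property for the pair [0], [fullv] gives a nonzero central [w]. Its line is an ideal,
    hence everything, and the bracket would be zero. *)
Lemma simple_not_all_nilpotent :
  lie_simple L -> ~ (forall x : L, lie_nilpotent x).
Proof.
move=> [[x0 [y0 xy0]] ideals] nil.
have [K [_ dK EK]] := engel_chain nil (leqnn _).
have {dK} KE : K = fullv by apply/eqP; rewrite eqEdim subvf dK leqnn.
have [|||w [_ w0 Kw]] := EK 0%VS fullv _ _ (sub0v _).
- by move=> x u _; rewrite !memv0 => /eqP->; rewrite lie0r.
- by move=> x u _ _; apply: memvf.
- rewrite subv0; apply: contraNneq xy0 => L0.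
  by have := memvf x0; rewrite L0 memv0 => /eqP->; rewrite lie0l.
have central x : lie x w = 0.
  by apply/eqP; rewrite -memv0 Kw // KE memvf.
case: (ideals <[w]>%VS) => [x _ /vlineP[c ->]|lw|lw].
- by rewrite lieZr central scaler0 mem0v.
- by move: w0; rewrite memv0; have := memv_line w; rewrite lw memv0 => ->.
have := memvf y0; rewrite -lw => /vlineP[c y0E].
by move: xy0; rewrite y0E lieZr central scaler0 eqxx.
Qed.

End Engel.

(** * Ad-nilpotency when the Killing form vanishes *)

Section Cartan.
Variables (F : fieldType) (L : lieAlgType F).
Implicit Types (x y z : L).

(** By Leibniz, [ad x - (a + b)] on a bracket is [ad x - a] on the left factor plus [ad x - b] on
    the right, so exponents add. *)
Lemma lie_geigen x i j a b y z :
  y \in geigen (lie_ad x) i a -> z \in geigen (lie_ad x) j b ->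
  lie y z \in geigen (lie_ad x) (i + j) (a + b).
Proof.
elim: i j y z => [|i IHi] j y z.
  by rewrite mem_geigen0 => /eqP-> _; rewrite lie0l mem0v.
elim: j y z => [|j IHj] y z yi zj.
  by move: zj; rewrite mem_geigen0 => /eqP->; rewrite lie0r mem0v.
rewrite addSn mem_geigenS.
have -> : lie_ad x (lie y z) - (a + b) *: lie y z =
    lie (lie_ad x y - a *: y) z + lie y (lie_ad x z - b *: z).
  rewrite lie_ad_derivation lieDl lieDr lieNl lieNr lieZl lieZr scalerDl opprD.
  by rewrite addrACA.
apply: memvD; first by apply: IHi => //; rewrite -mem_geigenS.
by rewrite addnS -addSn; apply: IHj => //; rewrite -mem_geigenS.
Qed.

Lemma lfun_trace_linear (f : 'End(L)) :
  linear (fun x => lfun_trace (f \o lie_ad x)%VF : F^o).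
Proof.
move=> c x y; rewrite lie_ad_is_linear comp_lfunDr -comp_lfunZr.
by rewrite /lfun_trace !linearP.
Qed.

(** The kernel of this linear form contains every bracket, so it is a nonzero ideal. *)
Lemma lfun_trace_simple0 D :
    lie_simple L -> (forall x y : L, killing x y = 0) -> derivation D ->
  forall x : L, lfun_trace (D \o lie_ad x)%VF = 0.
Proof.
move=> [[x0 [y0 xy0]] ideals] k0 dD.
pose lin := GRing.isLinear.Build F L F^o *:%R _ (lfun_trace_linear D).
pose phi : {linear L -> F^o} :=
  HB.pack (fun x => lfun_trace (D \o lie_ad x)%VF : F^o) lin.
have brk x y : lie x y \in lker (linfun phi).
  by rewrite memv_ker lfunE /= lfun_trace_derivation // k0.
case: (ideals (lker (linfun phi))) => [x y _|l0|lf x]; first exact: brk.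
  by have := brk x0 y0; rewrite l0 memv0 (negPf xy0).
by have := memvf x; rewrite -lf memv_ker lfunE /= => /eqP.
Qed.

End Cartan.

Lemma killing0_nilpotent (C : numClosedFieldType) (L : lieAlgType C) :
    lie_simple L -> (forall x y : L, killing x y = 0) ->
  forall x : L, lie_nilpotent x.
Proof.
move=> simL k0 x; set f := lie_ad x; set n := \dim {:L}.
have [r] := closed_field_poly_normal
  (char_poly (mxof (vbasis fullv) (vbasis fullv) f)).
rewrite (monicP (char_poly_monic _)) scale1r => fr.
(* The bracket of vectors for [a] and [b] lies in the space for [a + b] with exponent [n + n].
   Adding these sums to [s] fixes [D] there, even when [a + b] is no eigenvalue. *)
pose s := r ++ [seq a + b | a <- r, b <- r].
have rs : {subset r <= s} by move=> a ar; rewrite mem_cat ar.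
have rrs a b : a \in r -> b \in r -> a + b \in s.
  by move=> ar br; rewrite mem_cat allpairs_f ?orbT.
have le_n2 : (n <= n + n)%N by rewrite leq_addr.
have [D Ds] := diagonal_lfun (fun a : seq_sub s => (val a)^*)
  (geigen_direct f (n + n) s) (geigen_full le_n2 rs fr).
have {}Ds a v : a \in s -> v \in geigen f (n + n) a -> D v = a^* *: v.
  by move=> sa; apply: (Ds (SeqSub sa)).
have Dr a v : a \in r -> v \in geigen f n a -> D v = a^* *: v.
  by move=> ar /(subvP (geigen_addn _ _ n _)); apply/Ds/rs.
have fullr := geigen_full (leqnn _) (fun a (ar : a \in r) => ar) fr.
have dD : derivation D.
  apply: (derivation_of_cover fullr) => a b y z ya zb.
  have [ar br] := (valP a, valP b).
  rewrite (Dr _ _ ar ya) (Dr _ _ br zb) (Ds _ _ (rrs _ _ ar br)) ?lie_geigen //.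
  by rewrite rmorphD /= lieZl lieZr scalerDl.
(* Both [D] and [f] preserve the generalized eigenspaces, so a nonzero component of [v] is an
   eigenvector too. There [D] is the scalar [a^*]; unless this is 0, [f] has eigenvalue
   [alpha / a^*] on it, which must be [a]. *)
have eigenT alpha v : v != 0 -> D (f v) = alpha *: v ->
    alpha = 0 \/ exists a, alpha = a * a^*.
  move=> v0 Dfv.
  have /memv_sumP[vs Uv vE] : v \in (\sum_(a : seq_sub r) geigen f n (val a))%VS.
    by rewrite fullr memvf.
  have [a va0] : exists a, vs a != 0.
    apply/existsP; apply: contraNT v0; rewrite negb_exists => /forallP v0.
    by rewrite vE big1 // => a _; apply/eqP; rewrite -[_ == _]negbK v0.
  have eqa : (val a)^* *: f (vs a) = alpha *: vs a.
    have /directv_sum_unique/(_ (fun a => (val a)^* *: f (vs a))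
      (fun a => alpha *: vs a)) := geigen_direct f n r.
    have -> : (\sum_(a : seq_sub r) (val a)^* *: f (vs a)) = \sum_a alpha *: vs a.
      rewrite -scaler_sumr -vE -Dfv vE !linear_sum /=; apply: eq_bigr => b _.
      by rewrite (Dr _ _ (valP b)) // geigen_stable // Uv.
    rewrite eqxx => /(_ _ _)/esym/forall_inP/(_ a isT)/eqP; apply=> b _.
      by rewrite memvZ // geigen_stable // Uv.
    by rewrite memvZ // Uv.
  have [c0|c0] := eqVneq ((val a)^* : C) 0.
    left; apply/eqP; move/eqP: eqa; rewrite c0 scale0r eq_sym scaler_eq0.
    by rewrite (negPf va0) orbF.
  right; exists (val a).
  have fva : f (vs a) = (alpha / (val a)^*) *: vs a.
    by rewrite mulrC -scalerA -eqa scalerA mulVf ?scale1r.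
  by rewrite -[X in X * _](geigen_eigenvector (Uv a isT) fva va0) divfK.
(* An eigenvector of [f] for [a] is one of [D \o f] for [a^* * a]; that map has trace 0 and only
   nonnegative eigenvalues. *)
have ev0 a : a \in r -> a = 0.
  rewrite -root_prod_XsubC -fr -eigenvalue_root_char => /leigenvalueP[v v0 fv].
  have va : v \in geigen f (n + n) a.
    have v1 : v \in geigen f 1 a by rewrite mem_geigenS fv subrr mem0v.
    have n_gt0 : (0 < n)%N.
      rewrite lt0n dimv_eq0; apply: contraNneq v0 => n0.
      by rewrite -memv0 -n0 memvf.
    have := subvP (geigen_addn f 1 (n + n).-1 a) v v1.
    by rewrite addn1 prednK ?addn_gt0 ?n_gt0.
  have ar : a \in r.
    rewrite -root_prod_XsubC -fr -eigenvalue_root_char.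
    by apply/leigenvalueP; exists v.
  apply/eqP; rewrite -mul_conjC_eq0; apply/eqP.
  apply: (ge0_eigenvalue_mxtrace0 _ (lfun_trace_simple0 simL k0 dD x)).
    move=> b /leigenvalueP[w w0]; rewrite comp_lfunE => Dfw.
    by have [->|[c ->]] := eigenT _ _ w0 Dfw; rewrite ?mul_conjC_ge0.
  apply/leigenvalueP; exists v => //.
  by rewrite comp_lfunE -/f fv linearZ /= (Ds a) ?rs // scalerA.
have r0 : {subset r <= [:: 0]} by move=> a /ev0->; rewrite inE.
have full0 := geigen_full (leqnn _) r0 fr.
exists n => y; have {full0}: y \in geigen f n 0.
  apply: (subvP _ y (memvf y)); rewrite -full0; apply/subv_sumP => a _.
  by have := valP a; rewrite inE => /eqP->.
rewrite mem_geigen => /eqP fy; rewrite -[RHS]fy; apply: eq_iter => z.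
by rewrite scale0r subr0 lie_adE.
Qed.

(** The radical is an ideal by invariance; were it everything, each [ad x] would be nilpotent,
    against Engel. *)
Lemma killing_nondegenerate (C : numClosedFieldType) (L : lieAlgType C)
    (x : L) :
  lie_simple L -> (forall y, killing x y = 0) -> x = 0.
Proof.
move=> simL kx0; have [_ ideals] := simL.
case: (ideals (killing_orth (@fullv C L))) => [y z /mem_killing_orth zO|r0|rf].
- apply/mem_killing_orth => u _.
  by rewrite lieC -scaleN1r linearZl_LR /= killing_lie zO ?mulr0 ?memvf.
- by apply/eqP; rewrite -memv0 -r0; apply/mem_killing_orth => u _; apply: kx0.
case: (simple_not_all_nilpotent simL); apply: killing0_nilpotent => // y z.
by have := memvf y; rewrite -rf => /mem_killing_orth ->; rewrite ?memvf.
Qed.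

(** * Graded complements of the centralizer *)

(** Sending [x] to its row of pairings with a basis of [W] is injective on [U]. *)
Lemma dimv_le_pairing (F : fieldType) (V : vectType F) (b : V -> V -> F)
    (U W : {vspace V}) :
    (forall y, linear (b^~ y : V -> F^o)) ->
    (forall x, linear (b x : V -> F^o)) ->
    (forall x, x \in U -> (forall y, y \in W -> b x y = 0) -> x = 0) ->
  (\dim U <= \dim W)%N.
Proof.
move=> bl br bU.
have lin : linear (fun x => \row_(i < \dim W) b x (vbasis W)`_i).
  by move=> c x y; apply/rowP => i; rewrite !mxE bl.
pose lin' := GRing.isLinear.Build F V 'rV[F]_(\dim W) *:%R _ lin.
pose phi : {linear V -> 'rV[F]_(\dim W)} :=
  HB.pack (fun x => \row_(i < \dim W) b x (vbasis W)`_i) lin'.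
have kerU : (U :&: lker (linfun phi) = 0)%VS.
  apply/eqP; rewrite -subv0; apply/subvP => x /memv_capP[xU].
  rewrite memv_ker lfunE /= memv0 => /eqP x0.
  apply/eqP; apply: (bU x xU) => y yW.
  pose bx := GRing.isLinear.Build F V F^o *:%R _ (br x).
  pose psi : {linear V -> F^o} := HB.pack (b x : V -> F^o) bx.
  have -> : b x y = psi y by [].
  rewrite (coord_vbasis yW) linear_sum big1 // => i _.
  rewrite linearZ; have /rowP/(_ i) := x0; rewrite !mxE /= => ->.
  by rewrite scaler0.
rewrite -(limg_dim_eq kerU); apply: leq_trans (dimvS (subvf _)) _.
by rewrite dimvf dim_matrix mul1r.
Qed.

(** * Gradings and the degree derivation *)

Section Grading.
Variables (F : numFieldType) (L : lieAlgType F) (G : zgrading L).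
Implicit Types (x y z : L).
Local Notation I := (seq_sub (grade_supp G)).

Lemma piece_eq0 k : k \notin grade_supp G -> G k = 0%VS.
Proof. by rewrite grade_suppP negbK => /eqP. Qed.

Lemma piece_le_sum (P : pred int) k :
  P k -> (G k <= \sum_(j : I | P (val j)) G (val j))%VS.
Proof.
move=> Pk; have [ks|/piece_eq0->] := boolP (k \in grade_supp G).
  exact: (sumv_sup (SeqSub ks)).
exact: sub0v.
Qed.

(** The shift [c] serves the family of the [lie (xs j) e], with [c] the degree of [e]. A shifted
    degree outside the support carries only 0. *)
Lemma graded_sum_eq0 c (xs : I -> L) :
    (forall j, xs j \in G (val j + c)) -> \sum_j xs j = 0 ->
  forall j, xs j = 0.
Proof.
move=> Gxs xs0 j.
have [js|/piece_eq0 G0] := boolP (val j + c \in grade_supp G); last first.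
  by apply/eqP; rewrite -memv0 -G0 Gxs.
(* Reindexes by actual degree; each sum has at most one term. *)
pose us (k : I) := \sum_(i : I | val i + c == val k) xs i.
have <- : us (SeqSub js) = xs j.
  rewrite /us (big_pred1 j) // => i /=.
  by rewrite (inj_eq (addIr c)) val_eqE.
have := @directv_sum_independent _ _ _ xpredT (fun k : I => G (val k)).
move=> /elimT/(_ (grade_direct G)) indep; apply: (indep us) => // [k _|].
  by rewrite memv_suml // => i /eqP <-.
rewrite /us (exchange_big_dep xpredT) //= -[RHS]xs0; apply: eq_bigr => i _.
have [is_|/piece_eq0 G0] := boolP (val i + c \in grade_supp G).
  by rewrite (big_pred1 (SeqSub is_)) // => k /=; rewrite eq_sym -val_eqE.
have -> : xs i = 0 by apply/eqP; rewrite -memv0 -G0 Gxs.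
exact: big1.
Qed.

Lemma grading_derivation :
  exists2 D, derivation D & forall k x, x \in G k -> D x = k%:~R *: x.
Proof.
have [D DG] := diagonal_lfun (fun j : I => (val j)%:~R : F)
  (grade_direct G) (grade_full G).
have {}DG k x : x \in G k -> D x = k%:~R *: x.
  have [ks|/piece_eq0->] := boolP (k \in grade_supp G).
    exact: (DG (SeqSub ks)).
  by rewrite memv0 => /eqP->; rewrite linear0 scaler0.
exists D => //; apply: (derivation_of_cover (grade_full G)) => i j x y xi yj.
rewrite (DG _ _ xi) (DG _ _ yj) (DG _ _ (grade_lie xi yj)) lieZl lieZr.
by rewrite rmorphD /= scalerDl.
Qed.

(** Skewness of the degree derivation gives [(i + j) * killing x y = 0], and the characteristic is
    0. *)
Lemma killing_piece0 i j x y :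
  x \in G i -> y \in G j -> i + j != 0 -> killing x y = 0.
Proof.
have [D dD DG] := grading_derivation => xi yj ij.
have := killing_derivation x y dD; rewrite (DG _ _ xi) (DG _ _ yj).
rewrite linearZl_LR linearZr_LR /= => /eqP.
rewrite -addr_eq0 -mulrDl -rmorphD /= mulf_eq0 intr_eq0 (negPf ij).
by move/eqP.
Qed.

(** * Duality between complements, and the admissible pair *)

Section Complement.
Variables (e : L) (a : int).
Hypothesis ea : e \in G a.

Local Notation cent := (centralizer e).
Let V (j : I) := (G (val j) :\: cent)%VS.
Let S (P : pred int) := (\sum_(j : I | P (val j)) V j)%VS.

Lemma compl_le_piece j : (V j <= G (val j))%VS. Proof. exact: diffvSl. Qed.

Lemma compl_direct (P : pred int) : directv (\sum_(j : I | P (val j)) V j)%VS.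
Proof.
apply/directv_sum_independent => us Vus us0 j Pj.
have := @directv_sum_independent _ _ _ xpredT (fun k : I => G (val k)).
move=> /elimT/(_ (grade_direct G)) indep.
have := indep (fun j => if P (val j) then us j else 0) _ _ j isT; rewrite Pj.
apply.
  move=> k _; case: ifP => [Pk|_]; last exact: mem0v.
  exact: subvP (compl_le_piece k) _ (Vus k Pk).
by rewrite -big_mkcond.
Qed.

(** Bracketing with [e] shifts degrees by [a], so the brackets of the components vanish
    separately. *)
Lemma compl_sum_cap_centralizer P : (S P :&: cent = 0)%VS.
Proof.
apply/eqP; rewrite -subv0; apply/subvP => x /memv_capP[/memv_sumP[xs Vx ->]].
rewrite mem_centralizer lie_suml memv0 => /eqP x0.
apply/eqP/big1 => j Pj; apply/eqP; rewrite -memv0 -(capv_diff (G (val j)) cent).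
rewrite memv_cap Vx //= mem_centralizer.
have := @graded_sum_eq0 a (fun j => if P (val j) then lie (xs j) e else 0) _ _ j.
rewrite Pj => ->; rewrite ?eqxx -?big_mkcond //.
move=> k; case: ifP => [Pk|_]; last exact: mem0v.
by apply: grade_lie ea; apply: subvP (compl_le_piece k) _ (Vx k Pk).
Qed.

Lemma compl_sum_add_centralizer : (S xpredT + cent = fullv)%VS.
Proof.
apply/eqP; rewrite eqEsubv subvf -(grade_full G); apply/subv_sumP => j _.
rewrite -(addv_diff_cap (G (val j)) cent) addvS ?capvSr //.
exact: (sumv_sup j).
Qed.

Lemma compl_le_sum (P : pred int) (j : I) : P (val j) -> (V j <= S P)%VS.
Proof. by move=> Pj; apply: (sumv_sup j). Qed.

Lemma compl_sum_graded P : graded_subspace G (S P).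
Proof.
apply/eqP; rewrite eqEsubv; apply/andP; split; apply/subv_sumP => j Pj.
  by apply: (sumv_sup j) => //; rewrite subv_cap compl_le_sum ?compl_le_piece.
exact: capvSl.
Qed.

Lemma killing_lie_centralizer x y : y \in cent -> killing (lie x e) y = 0.
Proof.
rewrite mem_centralizer killing_lie (lieC e y) => /eqP->.
by rewrite oppr0 linear0r.
Qed.

Lemma killing_lie_compl_eq0 (P Q : pred int) x y :
    (forall i j, P i -> Q j -> i + a + j != 0) ->
  x \in S P -> y \in S Q -> killing (lie x e) y = 0.
Proof.
move=> PQ /memv_sumP[xs Vx ->] /memv_sumP[ys Vy ->].
rewrite lie_suml linear_sumlz big1 // => i Pi.
rewrite linear_sumr big1 // => j Qj.
apply: (@killing_piece0 (val i + a) (val j)); last exact: PQ.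
  by apply: grade_lie ea; apply: subvP (compl_le_piece i) _ (Vx i Pi).
exact: subvP (compl_le_piece j) _ (Vy j Qj).
Qed.

Hypothesis nondeg : forall x, (forall y, killing x y = 0) -> x = 0.

(** [lie x e] is orthogonal to [S Q] by assumption, to the other complements by degree and to the
    centralizer by invariance, hence is 0. *)
Lemma killing_lie_compl_nondeg (P Q : pred int) x :
    (forall i j, P i -> ~~ Q j -> i + a + j != 0) -> x \in S P ->
    (forall y, y \in S Q -> killing (lie x e) y = 0) ->
  x = 0.
Proof.
move=> PQ xP xQ; apply/eqP.
rewrite -memv0 -(compl_sum_cap_centralizer P) memv_cap xP.
rewrite mem_centralizer; apply/eqP/nondeg => y.
have /memv_addP[s sS [c cc ->]] : y \in (S xpredT + cent)%VS.
  by rewrite compl_sum_add_centralizer memvf.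
rewrite linearDr /= (killing_lie_centralizer _ cc) addr0.
case/memv_sumP: sS => ys Vy ->.
rewrite linear_sumr big1 // => j _; have [Qj|Qj] := boolP (Q (val j)).
  by apply: xQ; apply: subvP (compl_le_sum Qj) _ (Vy j isT).
apply: (@killing_lie_compl_eq0 P (predC Q)) => //.
by apply: subvP (@compl_le_sum (predC Q) j Qj) _ (Vy j isT).
Qed.

Lemma dim_compl_sum_le (P Q : pred int) :
  (forall i j, P i -> ~~ Q j -> i + a + j != 0) -> (\dim (S P) <= \dim (S Q))%N.
Proof.
move=> PQ; apply: (@dimv_le_pairing _ _ (fun x y => killing (lie x e) y)).
- by move=> y c x z; rewrite lieDl lieZl linearDl linearZl_LR.
- by move=> x c y z; rewrite linearDr linearZr_LR.
by move=> x; apply: killing_lie_compl_nondeg.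
Qed.

Lemma lie_compl_sum (P Q : pred int) k x y :
    (forall i j, P i -> Q j -> i + j <= k) -> x \in S P -> y \in S Q ->
  lie x y \in grade_le G k.
Proof.
move=> PQ /memv_sumP[xs Vx ->] /memv_sumP[ys Vy ->].
rewrite lie_suml memv_suml // => i Pi; rewrite lie_sumr memv_suml // => j Qj.
apply: (subvP (@piece_le_sum (fun l => l <= k) (val i + val j) _)); first exact: PQ.
apply: grade_lie; first exact: subvP (compl_le_piece i) _ (Vx i Pi).
exact: subvP (compl_le_piece j) _ (Vy j Qj).
Qed.

Lemma admissible_of_cap0 :
  1 < a -> (grade_le G (- a) :&: cent = 0)%VS -> admissible_grading G a e.
Proof.
(* The reflection sending [j] to [- a - j] exchanges the degrees of [m] and of [p] and maps those of
   [n] to those with [- a <= j + j]. *)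
move=> a1 cap0; pose m := S (fun j => j + j < - a);
pose n := S (fun j => j + j <= - a); pose p := S (fun j => ~~ (j + j <= - a)).
have le_m : (grade_le G (- a) <= m)%VS.
  apply/subv_sumP => j ja; rewrite -(addv_diff_cap (G (val j)) cent).
  have -> : (G (val j) :&: cent = 0)%VS.
    apply/eqP; rewrite -subv0 -cap0 capvS ?subvv //.
    exact: (@piece_le_sum (fun l => l <= - a)).
  by rewrite addv0; apply: compl_le_sum; lia.
have m_n : (m <= n)%VS by apply/subv_sumP => j ja; apply: compl_le_sum; lia.
have nn x y : x \in n -> y \in n -> lie x y \in m.
  move=> xn yn; apply: (subvP le_m); apply: lie_compl_sum xn yn => i j /=; lia.
have mn := subvP m_n.
have dimS P : (\dim (S P) = \sum_(j : I | P (val j)) \dim (V j))%N.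
  exact: directvP (compl_direct P).
have dim_mp : \dim m = \dim p.
  (* [m] and [p] are in duality, so the dimension bound holds both ways. *)
  by apply/eqP; rewrite eqn_leq !dim_compl_sum_le // => i j; lia.
have dim_np : (\dim n + \dim p = \dim (S xpredT))%N.
  by rewrite !dimS [RHS](bigID (fun j : I => val j + val j <= - a)).
have dim_cent : (\dim (S xpredT) + \dim cent = \dim {:L})%N.
  rewrite -compl_sum_add_centralizer dimv_disjoint_sum //.
  exact: compl_sum_cap_centralizer.
have e_n : (lie_img n e <= killing_orth m)%VS.
  apply/subvP => _ /memv_imgP[x xn ->]; rewrite lie_adrE.
  apply/mem_killing_orth => y ym.
  apply: killing_lie_compl_eq0 xn ym => i j; lia.
exists m, n; split=> //.
- by move=> x y /mn xn /mn; apply: nn.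
- by move=> x y xn yn; apply/mn/nn.
- exact: compl_sum_graded.
- exact: compl_sum_graded.
- apply/subv_sumP => j ja; apply: subv_trans (compl_le_piece j) _.
  by apply: (@piece_le_sum (fun l => l < 0)); lia.
(* (A3): modulo the centralizer, [x] is [y + z] with [y] in [n] and [z] in [p]. As [lie y e] is
   orthogonal to [m], so is [lie z e], and the duality of [p] with [m] forces [z = 0]. *)
- apply/eqP; rewrite eqEsubv subv_cap e_n limgS ?subvf // !andbT.
  apply/subvP => w /memv_capP[/mem_killing_orth wm /memv_imgP[x _ wE]].
  have /memv_addP[s sS [c cc xE]] : x \in (S xpredT + cent)%VS.
    by rewrite compl_sum_add_centralizer memvf.
  have /memv_addP[y yn [z zp sE]] : s \in (n + p)%VS.
    apply: subvP sS; apply/subv_sumP => j _.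
    have [jn|jp] := boolP (val j + val j <= - a).
      by apply: subv_trans (addvSl _ _); apply: compl_le_sum.
    by apply: subv_trans (addvSr _ _); apply: compl_le_sum.
  have {}wE : w = lie y e + lie z e.
    move: cc; rewrite wE xE sE lie_adrE !lieDl mem_centralizer => /eqP->.
    by rewrite addr0.
  have z0 : z = 0.
    apply: killing_lie_compl_nondeg zp _; last first.
      move=> u um; have := wm u um; rewrite wE linearDl /= -(lie_adrE y e).
      have /mem_killing_orth-> // := subvP e_n _ (memv_img (lie_adr e) yn).
      by rewrite add0r.
    by move=> i j; lia.
  by rewrite wE z0 lie0l addr0 -lie_adrE memv_img.
- exact: compl_sum_cap_centralizer.
- by move=> x y xn /mn; apply: nn.
by rewrite dim_mp addnC dim_np -dim_cent addnK.
Qed.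

End Complement.
End Grading.

Unset Implicit Arguments.

Theorem mainTheorem1 (R : realType) (g : lieAlgType R[i]) (e : g)
    (G : zgrading g) (a : int) :
  lie_simple g -> lie_nilpotent e -> 1 < a -> e \in G a ->
  (admissible_grading G a e <->
   (grade_le G (- a) :&: centralizer e)%VS = 0%VS).
Proof.
move=> simg _ a_gt1 ea; split=> [[m [n adm]]|].
  (* By (A2) the pieces of degree at most [- a] lie in [n], which meets the centralizer trivially by
     (A4). *)
  apply/eqP; rewrite -subv0 -(adm_cap adm) capvS //.
  exact: subv_trans (adm_le_m adm) (adm_m_n adm).
by apply: admissible_of_cap0 => // x; apply: killing_nondegenerate.
Qed.
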